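(* For all integers $t \geq 2$ and $n \geq 3$, the Dutch windmill graph $D_n^{(t)}$ is $2n$-periodic. For all positive integers $t$ and $n$, the uniform theta graph $\Theta(t,n)$ is $(2n+2)$-periodic.
   Context: Graphs are simple and finite. For a graph $G=(V,E)$, let $d_x$ be the degree of a vertex $x$ and let $\mathcal{A}=\{(x,y),(y,x) \mid \{x,y\}\in E\}$ be the set of symmetric arcs. For an arc $a=(x,y)$ write $o(a)=x$ (origin), $t(a)=y$ (terminus) and $a^{-1}=(y,x)$. The time evolution matrix of the Grover walk on $G$ is $U=U(G)\in\mathbb{C}^{\mathcal{A}\times\mathcal{A}}$ with entries \[ U_{a,b} = \frac{2}{d_{t(b)}}\,\delta_{o(a),t(b)} - \delta_{a,b^{-1}}, \] where $\delta$ is the Kronecker delta. For a positive integer $\tau$, $G$ is called $\tau$-periodic if $\tau$ is the smallest positive integer with $U(G)^\tau = I$. The Dutch windmill graph $D_n^{(t)}$ is obtained from $t$ disjoint copies of the cycle graph $C_n$ on $n$ vertices by identifying one vertex from each copy into a single common vertex. The uniform theta graph $\Theta(t,n)$ is obtained from $t$ pairwise vertex-disjoint path graphs on $n$ vertices by adding two new vertices and, for each path, joining one endpoint to the first new vertex and the other endpoint to the second new vertex (when $n=1$ the single vertex of each path is joined to both new vertices). *)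

(* Defs.v *)
From HB Require Import structures.
From mathcomp Require Import all_boot all_order all_algebra.
From mathcomp Require Import reals complex.

Set Implicit Arguments.
Unset Strict Implicit.
Unset Printing Implicit Defensive.

Import GRing.Theory.

Local Open Scope ring_scope.
Local Open Scope complex_scope.

Record sgraph := SGraph {
  vertex :> finType;
  adj : rel vertex;
  adj_sym : symmetric adj;
  adj_irrefl : irreflexive adj }.

Section SimpleGraphOfRel.
Variables (V : finType) (e : rel V).

Definition simple_rel : rel V := fun x y => (x != y) && (e x y || e y x).

Lemma simple_rel_sym : symmetric simple_rel.
Proof. by move=> x y; rewrite /simple_rel eq_sym orbC. Qed.

Lemma simple_rel_irrefl : irreflexive simple_rel.
Proof. by move=> x; rewrite /simple_rel eqxx. Qed.

Definition sgraph_of_rel : sgraph := SGraph simple_rel_sym simple_rel_irrefl.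
End SimpleGraphOfRel.

Definition degree (G : sgraph) (x : G) : nat := #|[set y | adj x y]|.

Section GroverWalk.
Variable G : sgraph.

Definition arc : finType := {p : G * G | adj p.1 p.2}.

Definition origin (a : arc) : G := (val a).1.
Definition terminus (a : arc) : G := (val a).2.

Lemma arc_inv_subproof (a : arc) : adj (terminus a) (origin a).
Proof. by rewrite adj_sym; exact: (valP a). Qed.

Definition arc_inv (a : arc) : arc :=
  exist _ (terminus a, origin a) (arc_inv_subproof a).

Variable R : realType.

Definition grover_entry (a b : arc) : R[i] :=
  2%:R / (degree (terminus b))%:R * (origin a == terminus b)%:R
  - (a == arc_inv b)%:R.

(* Arcs are numbered by [enum_val], since matrices are indexed by ordinals. *)
Definition grover_mx : 'M[R[i]]_#|arc| :=
  \matrix_(i, j) grover_entry (enum_val i) (enum_val j).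

Definition periodic (tau : nat) : Prop :=
  [/\ (0 < tau)%N,
      grover_mx ^+ tau = 1%:M &
      forall s : nat, (0 < s < tau)%N -> grover_mx ^+ s <> 1%:M].
End GroverWalk.

Definition path_graph (n : nat) : sgraph :=
  sgraph_of_rel (fun i j : 'I_n => i.+1 == j :> nat).

(* [ordS] is the successor modulo [n]; this is the n-cycle for 2 < n. *)
Definition cycle_graph (n : nat) : sgraph :=
  sgraph_of_rel (fun i j : 'I_n => ordS i == j).

Definition disjoint_copies (t : nat) (G : sgraph) : sgraph :=
  sgraph_of_rel
    (fun p q : 'I_t * G => (p.1 == q.1) && adj p.2 q.2).

(* All vertices satisfying [P] are merged into the single vertex [None]: the
   projection [insub] sends [x] to [None] if [P x], and to [Some x] otherwise.
   Two vertices of the quotient are adjacent when they have adjacent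
   preimages. *)
Definition identify (G : sgraph) (P : pred G) : sgraph :=
  sgraph_of_rel
    (fun x y : option {z : G | ~~ P z} =>
       [exists u : G, exists v : G,
          [&& adj u v, insub u == x & insub v == y]]).

Definition dutch_windmill (n t : nat) : sgraph :=
  @identify (disjoint_copies t (cycle_graph n))
    (fun p : 'I_t * 'I_n => p.2 == 0%N :> nat).

(* [inr false] and [inr true] are the two added vertices. *)
Definition theta_graph (t n : nat) : sgraph :=
  sgraph_of_rel
    (fun x y : disjoint_copies t (path_graph n) + bool =>
       match x, y with
       | inl p, inl q => adj p q
       | inl (_, k), inr false => k == 0%N :> nat
       | inl (_, k), inr true => k == n.-1 :> nat
       | inr _, _ => false
       end).

(* Main.v *)
Require Import Defs.
From mathcomp Require Import all_boot all_order all_algebra.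
From mathcomp Require Import reals complex.
From mathcomp Require Import zify ring.

Set Implicit Arguments.
Unset Strict Implicit.
Unset Printing Implicit Defensive.

Import GRing.Theory Num.Theory.
Local Open Scope ring_scope.
Local Open Scope complex_scope.

(* Both graphs subdivide a multigraph (t loops at one vertex, resp. t parallel
   edges) into paths of m edges, with m = n, resp. m = n + 1.  Call a path with
   a direction a lane.  At a vertex of degree 2 the Grover walk moves straight
   on, so an amplitude travels along its lane and is scattered at the end by
   the Grover coin of the hub reached there.  Hence U^m acts on the amplitudes
   at a given position of the lanes as the scattering operator [coin] of the
   multigraph, and in both cases [coin] is an involution, whence U^(2m) = I.
   Conversely, for 0 < s < m an amplitude starting on the first arc of a lane
   is on another arc at time s, and U^m <> I since [coin] has a diagonal entry
   different from 1; a period s > m would give the period 2m - s < m. *)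

(** * The Grover walk on amplitudes indexed by pairs of vertices *)

Section ArcValues.
Variables (G : sgraph) (R : realType).
Implicit Types (v : 'cV[R[i]]_#|Defs.arc G|) (x y z : G).

(** The value 0 off the arcs makes the amplitude a total function of two vertices, so no adjacency
    proof is carried through rewriting. *)
Definition arcval v x y : R[i] :=
  if insub (x, y) is Some a then v (enum_rank (a : Defs.arc G)) 0 else 0.

Lemma arcval_arc v (a : Defs.arc G) :
  arcval v (origin a) (terminus a) = v (enum_rank a) 0.
Proof.
rewrite /arcval /origin /terminus; case: insubP => [b _ vb|].
  by congr (v (enum_rank _) _); apply: val_inj; rewrite vb -surjective_pairing.
by rewrite -surjective_pairing (valP a).
Qed.

Lemma arcval_ext v v' :
  (forall x y, adj x y -> arcval v x y = arcval v' x y) -> v = v'.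
Proof.
move=> eq_v; apply/colP=> i; rewrite -(enum_valK i) -!arcval_arc.
exact/eq_v/(valP (enum_val i)).
Qed.

Lemma arcval_delta x y :
  adj x y -> exists v, forall x' y', arcval v x' y' = ((x', y') == (x, y))%:R.
Proof.
move=> xy; pose a : Defs.arc G := exist _ (x, y) xy.
exists (\col_i (i == enum_rank a)%:R) => x' y'; rewrite /arcval.
case: insubP => [b _ vb|nadj].
  by rewrite mxE (inj_eq enum_rank_inj) -val_eqE /= vb.
by case: eqP nadj => // ->; rewrite /= xy.
Qed.

Lemma arcval_grover v x y : adj x y ->
  arcval (grover_mx G R *m v) x y
  = 2%:R / (degree x)%:R * (\sum_(z | adj x z) arcval v z x) - arcval v y x.
Proof.
move=> xy; pose a : Defs.arc G := exist _ (x, y) xy.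
rewrite -[x in LHS]/(origin a) -[y in LHS]/(terminus a) arcval_arc mxE.
rewrite (reindex (@enum_rank (Defs.arc G))) /=; last exact/onW_bij/enum_rank_bij.
under eq_bigr => b _ do
  rewrite mxE !enum_rankK /grover_entry -arcval_arc mulrBl.
rewrite sumrB; congr (_ - _); last first.
  rewrite (bigD1 (arc_inv a)) //= big1 => [|b ba].
    rewrite (_ : a == arc_inv (arc_inv a)) ?mul1r ?addr0 //.
    by apply/eqP/val_inj.
  rewrite (_ : (a == arc_inv b) = false) ?mul0r //.
  apply/negP=> /eqP ab; case/eqP: ba; apply: val_inj.
  by rewrite /= ab /= -surjective_pairing.
(* Arcs into [x] are indexed by their origins; the fallback [a] of the inverse map is never reached
   when [z] is a neighbour of [x]. *)
rewrite mulr_sumr (reindex_onto (fun b : Defs.arc G => origin b)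
  (fun z => if insub (z, x) is Some b then b else a)) /=; last first.
  move=> z xz; case: insubP => [b _ vb|]; first by rewrite /origin vb.
  by rewrite /= adj_sym xz.
rewrite [RHS]big_mkcond /=; apply: eq_bigr => b _.
case: eqP => [tb|tb] /=.
  have tb' : x = terminus b by [].
  rewrite [in RHS]tb' adj_sym (valP b) /= mulr1.
  have -> : insub (origin b, terminus b) = Some b.
    by rewrite /origin /terminus -surjective_pairing; exact: valK.
  by rewrite eqxx.
rewrite mulr0 mul0r; case: insubP => [c _ vc|nadj].
  case: ifP => // /andP[_ /eqP cb]; case: tb.
  by rewrite -cb /terminus vc.
by rewrite /= adj_sym in nadj; rewrite (negPf nadj).
Qed.

(* The index type lists the neighbours of [x] once each. *)
Lemma arcval_grover_nb (I : finType) (P : pred I) (nb : I -> G) v x y :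
    {in P &, injective nb} ->
    (forall z, adj x z <-> exists2 i, P i & z = nb i) -> adj x y ->
  arcval (grover_mx G R *m v) x y
  = 2%:R / #|P|%:R * (\sum_(i | P i) arcval v (nb i) x) - arcval v y x.
Proof.
move=> nb_inj nbP xy.
have nbE z : adj x z = (z \in [set nb i | i in P]).
  apply/idP/imsetP=> [/nbP[i Pi ->]|[i Pi ->]]; first by exists i.
  by apply/nbP; exists i.
have -> : #|P| = degree x.
  rewrite -(card_in_imset nb_inj) /degree.
  by apply: eq_card => z; rewrite !inE nbE.
rewrite arcval_grover // (eq_bigl _ _ nbE) big_imset //.
Qed.

Lemma grover_expS s v :
  grover_mx G R ^+ s.+1 *m v = grover_mx G R *m (grover_mx G R ^+ s *m v).
Proof. by rewrite exprS -mulmxE mulmxA. Qed.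

Lemma grover_expD s s' v :
  grover_mx G R ^+ (s + s') *m v
  = grover_mx G R ^+ s *m (grover_mx G R ^+ s' *m v).
Proof. by rewrite exprD -mulmxE mulmxA. Qed.

End ArcValues.

(** * Transport along lanes and scattering at hubs *)

Section Lanes.
(* [w l k] is the [k]-th vertex of the lane [l], meaningful for [k <= m], and [r]
   reverses lanes. Each arc lies on exactly one lane. *)
Variables (G : sgraph) (R : realType) (L : finType) (r : L -> L).
Variables (w : L -> nat -> G) (m : nat).

Hypothesis m_gt1 : (1 < m)%N.
Hypothesis rK : involutive r.
Hypothesis r_neq : forall l, r l != l.
Hypothesis w_rev : forall l k, (k <= m)%N -> w (r l) k = w l (m - k)%N.
Hypothesis w_adj : forall x y,
  adj x y <-> exists l k, [/\ (k < m)%N, x = w l k & y = w l k.+1].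
Hypothesis w_inj : forall l l' k k', (0 < k < m)%N -> (k' <= m)%N ->
  w l' k' = w l k -> l' = l /\ k' = k \/ l' = r l /\ k' = (m - k)%N.
(** [w_ends] makes [r] permute the classes of lanes with a common origin, on which [coinK] rests.
    [w_loop] rules out loops of two edges, whose inner vertex would have a single neighbour. *)
Hypothesis w_ends : forall l l', w l 0 = w l' 0 -> w l m = w l' m.
Hypothesis w_loop : forall l, w l 0 = w l m -> (2 < m)%N.

Implicit Types (v : 'cV[R[i]]_#|Defs.arc G|) (l : L) (g : L -> R[i]).

Lemma lane_adj l k : (k < m)%N -> adj (w l k) (w l k.+1).
Proof. by move=> km; apply/w_adj; exists l, k. Qed.

Lemma lane_end l : w l m = w (r l) 0.
Proof. by rewrite w_rev // subn0. Qed.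

Lemma lane_inner_nb l k z : (0 < k < m)%N ->
  adj (w l k) z <-> exists2 b : bool, true & z = w l (if b then k.+1 else k.-1).
Proof.
case/andP=> k0 km; split=> [|[[] _ ->]]; last 2 first.
- exact: lane_adj.
- by rewrite adj_sym -{2}(prednK k0) lane_adj // prednK // ltnW.
case/w_adj=> l' [k' [k'm wE ->]].
have kin : (0 < k < m)%N by rewrite k0.
have [[-> ->]|[-> k'E]] := w_inj kin (ltnW k'm) (esym wE); first by exists true.
exists false => //; rewrite w_rev; last by lia.
by congr (w l _); lia.
Qed.

(** One of the positions [k.-1], [k.+1] is itself inner, so [w_inj] applies, unless [k = 1] and
    [m = 2]; equality would then close a loop of two edges, against [w_loop]. *)
Lemma lane_inner_inj l k : (0 < k < m)%N -> w l k.+1 <> w l k.-1.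
Proof.
case/andP=> k0 km wE.
have [k1|k1] := ltnP 1 k.
  have kin : (0 < k.-1 < m)%N by lia.
  have [[_]|[/eqP]] := w_inj kin km wE;
    [lia | by rewrite eq_sym (negPf (r_neq l))].
have kE : k = 1%N by lia.
rewrite kE /= in km wE.
have [m2|m2] := ltnP 2 m.
  have kin : (0 < 2 < m)%N by lia.
  have [[_]|[/eqP]] := w_inj kin (leq0n m) (esym wE);
    [lia | by rewrite eq_sym (negPf (r_neq l))].
have mE : m = 2%N by lia.
by have := @w_loop l; rewrite mE => /(_ (esym wE)).
Qed.

(** At degree 2 the factor 2/2 is 1, and subtracting the reflected amplitude cancels one of the two
    incoming ones: nothing is sent back. *)
Lemma lane_shift v l k : (k.+1 < m)%N ->
  arcval (grover_mx G R *m v) (w l k.+1) (w l k.+2)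
  = arcval v (w l k) (w l k.+1).
Proof.
move=> km; have kin : (0 < k.+1 < m)%N by [].
rewrite (@arcval_grover_nb _ _ bool xpredT
  (fun b => w l (if b then k.+2 else k))); first last.
- exact: lane_adj.
- by move=> z; apply: lane_inner_nb.
- have := lane_inner_inj (l := l) kin => /= wn.
  by move=> [] [] _ _ // wE; case: wn.
rewrite card_bool divff ?pnatr_eq0 // mul1r big_bool /=; ring.
Qed.

Lemma lane_hub_nb l z :
  adj (w l 0) z <-> exists2 l', w l' 0 == w l 0 & z = w l' 1.
Proof.
split=> [/w_adj[l' [k [km wE ->]]]|[l' /eqP <- ->]]; last first.
  by apply: lane_adj; apply: ltnW.
have [k0|k0] := posnP k; first by exists l'; rewrite ?k0 // wE k0.
have kin : (0 < k < m)%N by rewrite k0.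
by have [[_]|[_]] := w_inj kin (leq0n m) wE; lia.
Qed.

(** Needed for the number of hubmates to be the degree of the hub. Two distinct lanes sharing their
    first edge would be mutually reverse with [m = 2], again a forbidden loop. *)
Lemma lane_hub_inj l :
  {in [pred l' | w l' 0 == w l 0] &, injective (w ^~ 1%N)}.
Proof.
move=> l1 l2; rewrite !inE => /eqP w1 /eqP w2 wE.
have kin : (0 < 1 < m)%N by [].
have [[]|[l1E mE]] // := w_inj kin (ltnW m_gt1) wE.
have := @w_loop l2; rewrite lane_end -l1E w1 w2 => /(_ erefl); lia.
Qed.

(* Each [l'] starting at the hub [w l 0] stands for the lane [r l'] entering it. *)
Definition hubmates l := [pred l' | w l' 0 == w l 0].

Definition coin g l : R[i] :=
  2%:R / #|hubmates l|%:R * (\sum_(l' in hubmates l) g (r l')) - g (r l).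

Lemma lane_coin v l :
  arcval (grover_mx G R *m v) (w l 0) (w l 1)
  = coin (fun l' => arcval v (w l' m.-1) (w l' m)) l.
Proof.
have m0 := ltnW m_gt1.
(* The first arc of a lane, reversed, is the last arc of the reverse lane. *)
have back l' : (w l' 1 = w (r l') m.-1) /\ w l' 0 = w (r l') m.
  by rewrite lane_end rK w_rev ?leq_pred //; split=> //; congr (w l' _); lia.
rewrite (@arcval_grover_nb _ _ L (hubmates l) (w ^~ 1%N)); first last.
- exact: lane_adj.
- by move=> z; exact: lane_hub_nb.
- exact: lane_hub_inj.
rewrite /coin; have [<- <-] := back l; congr (_ * _ - _).
apply: eq_bigr => l' /eqP w0.
by have [<- <-] := back l'; rewrite w0.
Qed.

Lemma hubmates_rev l l' : (r l' \in hubmates l) = (l' \in hubmates (r l)).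
Proof.
rewrite !inE; apply/eqP/eqP => /w_ends; rewrite !lane_end !rK //.
Qed.

Lemma hubmates_eq l l' : l' \in hubmates l -> hubmates l' =i hubmates l.
Proof. by rewrite inE => /eqP w0 l''; rewrite !inE w0. Qed.

Lemma card_hubmates_rev l : #|hubmates (r l)| = #|hubmates l|.
Proof.
rewrite -(card_image (can_inj rK)); apply: eq_card => l'.
rewrite -[l' in LHS]rK mem_map; last exact: (can_inj rK).
by rewrite mem_enum -hubmates_rev rK.
Qed.

Lemma card_hubmates_neq0 l : #|hubmates l|%:R != 0 :> R[i].
Proof.
by rewrite pnatr_eq0 -lt0n; apply/card_gt0P; exists l; rewrite inE.
Qed.

Lemma sum_hubmates_rev g l :
  \sum_(l' in hubmates (r l)) g (r l') = \sum_(l' in hubmates l) g l'.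
Proof.
rewrite (reindex_inj (can_inj rK)) /=; apply: eq_big => l' => [|_].
  by rewrite hubmates_rev rK.
by rewrite rK.
Qed.

(** On a class of d hubmates, [coin] is lane reversal followed by the reflection 2J/d - 1, with J
    the all-ones matrix. Reversal maps classes to classes of equal size, hence commutes with the
    reflections, and both square to the identity. *)
Lemma coinK g l : coin (coin g) l = g l.
Proof.
have cE l' : l' \in hubmates l -> coin g (r l') =
    2%:R / #|hubmates l|%:R * (\sum_(k in hubmates l) g k) - g l'.
  move=> /hubmates_eq l'E; rewrite /coin card_hubmates_rev sum_hubmates_rev rK.
  by rewrite (eq_card l'E) (eq_bigl _ _ l'E).
rewrite {1}/coin (eq_bigr _ cE) cE ?inE // sumrB sumr_const -mulr_natr.
have := card_hubmates_neq0 l; set d := #|_|%:R; set S := \sum_(k in _) _ => d0.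
by field.
Qed.

Lemma lane_shiftn v l j k : (j + k < m)%N ->
  arcval (grover_mx G R ^+ j *m v) (w l (j + k)%N) (w l (j + k).+1)
  = arcval v (w l k) (w l k.+1).
Proof.
elim: j => [|j IHj] jkm; first by rewrite expr0 mul1mx.
by rewrite grover_expS addSn lane_shift // IHj // ltnW.
Qed.

Lemma eq_coin g g' l : g =1 g' -> coin g l = coin g' l.
Proof. by move=> eqg; rewrite /coin (eq_bigr _ (fun l' _ => eqg (r l'))) eqg. Qed.

Lemma lane_round v l k : (k < m)%N ->
  arcval (grover_mx G R ^+ m *m v) (w l k) (w l k.+1)
  = coin (fun l' => arcval v (w l' k) (w l' k.+1)) l.
Proof.
(* Going back in time: [k] straight steps after the hub, one scattering, and [m.-1 - k] straight
   steps before it. *)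
move=> km; rewrite -{1}(subnKC (ltnW km)) grover_expD.
have := lane_shiftn (grover_mx G R ^+ (m - k) *m v) l (j := k) (k := 0).
rewrite addn0 => -> //.
have -> : (m - k = (m.-1 - k).+1)%N by lia.
rewrite grover_expS lane_coin; apply: eq_coin => l'.
have mE : (m.-1 - k + k = m.-1)%N by lia.
have := @lane_shiftn v l' (m.-1 - k) k; rewrite mE prednK; last by lia.
by apply; lia.
Qed.

Lemma lane_grover_exp : grover_mx G R ^+ (2 * m) = 1%:M.
Proof.
suff Uv v : grover_mx G R ^+ (2 * m) *m v = v.
  apply/matrixP => i j; have /colP/(_ i) := Uv (delta_mx j 0).
  by rewrite -colE !mxE eqxx andbT.
apply: arcval_ext => _ _ /w_adj[l [k [km -> ->]]].
rewrite mul2n -addnn grover_expD lane_round //.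
rewrite -[RHS](coinK (fun l' => arcval v (w l' k) (w l' k.+1))).
by apply: eq_coin => l'; rewrite lane_round.
Qed.

Lemma lane_grover_exp_small s : (0 < s < m)%N -> inhabited L ->
  grover_mx G R ^+ s <> 1%:M.
Proof.
move=> /andP[s0 sm] [l] U1.
have /(arcval_delta R)[v vE] : adj (w l 0) (w l 1) by apply: lane_adj; lia.
have := @lane_shiftn v l s 0; rewrite addn0 U1 mul1mx !vE eqxx => /(_ sm).
case: ((_, _) =P _) => [[ws _] _|_ /eqP]; last by rewrite eq_sym oner_eq0.
have sin : (0 < s < m)%N by rewrite s0.
by have [[_]|[_]] := w_inj sin (leq0n m) (esym ws); lia.
Qed.

(** The diagonal entry of [coin] at [l0] is 2/d if both ends of [l0] are the same hub, with d
    hubmates, and 0 otherwise. The hypothesis excludes d = 2, where the entry would be 1, as on a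
    single cycle. *)
Lemma lane_periodic l0 :
  (w l0 0 = w l0 m -> (2 < #|hubmates l0|)%N) -> periodic G R (2 * m).
Proof.
move=> big_hub; split; [by lia | exact: lane_grover_exp |].
move=> s /andP[s0 s2m] U1.
have [sm|ms|sm] := ltngtP s m.
- by case: (@lane_grover_exp_small s); rewrite ?s0.
- case: (@lane_grover_exp_small (2 * m - s)); [by lia | by [] |].
  have := lane_grover_exp; rewrite -[in X in X -> _](subnK (ltnW s2m)) exprD U1.
  by rewrite -mulmxE mulmx1.
have m0 := ltnW m_gt1.
have /(arcval_delta R)[v vE] : adj (w l0 0) (w l0 1) by apply: lane_adj; lia.
have := @lane_round v l0 0 m0; rewrite -{1}sm U1 mul1mx vE eqxx.
have dE l : arcval v (w l 0) (w l 1) = (l == l0)%:R.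
  rewrite vE; congr (nat_of_bool _)%:R.
  apply/eqP/eqP => [[w0 w1]|-> //]; apply: (lane_hub_inj (l := l0)) => //.
    by rewrite inE w0.
  by rewrite inE.
rewrite (eq_coin _ dE) /coin (negPf (r_neq l0)) subr0.
have [hub|nhub] := boolP (r l0 \in hubmates l0).
  rewrite (bigD1 (r l0)) //= rK eqxx big1 ?addr0 ?mulr1; last first.
    move=> l /andP[_]; apply: contraNeq; rewrite pnatr_eq0 eqb0 negbK.
    by move/eqP<-; rewrite rK.
  move/(congr1 (fun x => x * #|hubmates l0|%:R)).
  rewrite mul1r divfK ?card_hubmates_neq0 // => /eqP; rewrite eqr_nat => /eqP d2.
  move: hub; rewrite inE -lane_end => /eqP hub.
  by have := big_hub (esym hub); rewrite d2.
rewrite big1 ?mulr0 => [/eqP|l hl]; first by rewrite oner_eq0.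
case: eqP => // rl; case/negP: nhub; by rewrite -{1}rl rK.
Qed.

End Lanes.

(** * Strands with common ends, each run in both directions *)

Section Bundles.
Variables (G : sgraph) (R : realType) (I : finType) (st : I -> nat -> G).
Variable m : nat.

Hypothesis m_gt1 : (1 < m)%N.
Hypothesis st_adj : forall x y, adj x y <-> exists p k, (k < m)%N /\
  (x = st p k /\ y = st p k.+1 \/ y = st p k /\ x = st p k.+1).
Hypothesis st_inj : forall p p' k k', (0 < k < m)%N -> (k' <= m)%N ->
  st p' k' = st p k -> p' = p /\ k' = k.
Hypothesis st0 : forall p p', st p 0 = st p' 0.
Hypothesis stm : forall p p', st p m = st p' m.
Hypothesis st_loop : forall p, st p 0 = st p m -> (2 < m)%N.

Definition bundle_rev (l : I * bool) := (l.1, ~~ l.2).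
Definition bundle_lane (l : I * bool) k := st l.1 (if l.2 then m - k else k)%N.

(** If the two ends coincide, all 2|I| directed strands leave the one hub, so two strands already
    give more than two hubmates. *)
Lemma bundle_periodic p0 :
  (st p0 0 = st p0 m -> (1 < #|I|)%N) -> periodic G R (2 * m).
Proof.
move=> big_hub; apply: (@lane_periodic G R _ bundle_rev bundle_lane m _ _ _ _ _ _ _ _
          (p0, false)).
- exact: m_gt1.
- by case=> p b; rewrite /bundle_rev /= negbK.
- by case=> p b; rewrite xpair_eqE; case: b; rewrite andbF.
- case=> p [] k km //; rewrite /bundle_lane /=.
  by congr (st p _); lia.
- move=> x y; split=> [/st_adj[p [k [km]]]|[[p b] [k [km -> ->]]]].
    case=> -[-> ->]; first by exists (p, false), k.
    exists (p, true), (m - k.+1)%N; rewrite /bundle_lane /=.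
    by split; [lia | congr (st p _); lia | congr (st p _); lia].
  apply/st_adj; rewrite /bundle_lane /=; case: b; last first.
    by exists p, k; split=> //; left.
  exists p, (m - k.+1)%N; split; first by lia.
  by right; split=> //; congr (st p _); lia.
- move=> [p b] [p' b'] k k' kin k'm; rewrite /bundle_lane /bundle_rev /=.
  have bin : (0 < (if b then m - k else k) < m)%N by case: b; lia.
  have b'm : ((if b' then m - k' else k') <= m)%N by case: b'; lia.
  move=> /(st_inj bin b'm)[-> kE].
  by case: b b' kE {bin b'm} => [] [] /= kE; [left|right|right|left];
    split=> //; lia.
(* Lanes of opposite directions with a common origin force the two ends of the bundle to
   coincide. *)
- move=> [p b] [p' b'] /=; rewrite /bundle_lane /=.
  case: b b' => [] [] /=; rewrite ?subn0 ?subnn //.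
  + by rewrite -(st0 p p') (stm p p').
  + by rewrite -(st0 p p') (stm p p') => ->.
- case=> p []; rewrite /bundle_lane /= ?subn0 ?subnn; last exact: st_loop.
  by move/esym; exact: st_loop.
rewrite /bundle_lane /= => /[dup] loop /big_hub I2.
have allmates : hubmates bundle_lane (p0, false) =i predT.
  move=> [p b]; rewrite !inE /bundle_lane /=; apply/eqP.
  by case: b; rewrite ?subn0 ?(st0 p p0) // (stm p p0).
by rewrite (eq_card allmates) card_prod card_bool; lia.
Qed.
End Bundles.

(** * Petals of the Dutch windmill graph *)

Section Windmill.
Variables (t n : nat).
Local Notation W := (dutch_windmill n.+1 t).

(* [inZp] wraps position [n.+1] to the hub. *)
Definition petal (p : 'I_t) (k : nat) : W := insub (p, inZp k : 'I_n.+1).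

Lemma petal_hub p k : (n.+1 %| k)%N -> petal p k = None.
Proof. by move=> nk; rewrite /petal insubF //= -/(n.+1 %| k)%N nk. Qed.

Lemma petal_inj p p' k k' : (0 < k < n.+1)%N -> (k' <= n.+1)%N ->
  petal p' k' = petal p k -> p' = p /\ k' = k.
Proof.
move=> /andP[k0 kn] k'n.
rewrite [RHS]insubT /= ?modn_small -?lt0n // => kP.
rewrite /petal; case: insubP => // u _ uE [uE'].
move: uE; rewrite uE' /= => -[-> kE]; split=> //.
move: kE; rewrite (modn_small kn) /=.
move: k'n; rewrite leq_eqVlt => /orP[/eqP->|k'n]; first by rewrite modnn; lia.
by rewrite modn_small.
Qed.

Lemma petal_adj (n_gt0 : (0 < n)%N) x y : adj x y <-> exists p k, (k < n.+1)%N /\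
  (x = petal p k /\ y = petal p k.+1 \/ y = petal p k /\ x = petal p k.+1).
Proof.
have ordSE (i : 'I_n.+1) : ordS i = inZp i.+1 by apply: val_inj.
have step p k : (k < n.+1)%N -> adj (petal p k) (petal p k.+1).
  move=> kn; rewrite /adj /= /simple_rel; apply/andP; split.
    apply/eqP => pE; have [k0|k0] := posnP k.
      have kin : (0 < k.+1 < n.+1)%N by rewrite k0 ltnS.
      by have [_] := petal_inj kin (ltnW kn) pE; lia.
    have kin : (0 < k < n.+1)%N by rewrite k0.
    by have [_] := petal_inj kin kn (esym pE); lia.
  apply/orP; left; apply/existsP; exists (p, inZp k).
  apply/existsP; exists (p, inZp k.+1).
  have kS : inZp k != inZp k.+1 :> 'I_n.+1.
    rewrite -val_eqE /= modn_small //.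
    (* At [k = n] the successor wraps to 0, which differs from [n] by [n_gt0]. *)
    move: (kn); rewrite ltnS leq_eqVlt => /orP[/eqP->|k1]; last first.
      by rewrite modn_small //; lia.
    by rewrite modnn; lia.
  have kO : ordS (inZp k) = inZp k.+1 :> 'I_n.+1.
    by apply: val_inj; rewrite /= (modn_small kn).
  by rewrite /petal !eqxx !andbT /= /simple_rel /= xpair_eqE !eqxx /= kS kO eqxx.
split=> [|[p [k [kn]]]]; last first.
  by case=> -[-> ->]; [|rewrite adj_sym]; exact: step.
(* Conversely, a quotient edge lifts to a cycle edge in one copy; [k] is the index of the endpoint
   whose [ordS] is the other endpoint. *)
have edge u v : adj (u : disjoint_copies t (cycle_graph n.+1)) v ->
    exists p k, (k < n.+1)%N /\ (u = (p, inZp k) /\ v = (p, inZp k.+1) \/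
                               v = (p, inZp k) /\ u = (p, inZp k.+1)).
  case: u v => p i [q j]; rewrite /adj /= /simple_rel /=.
  rewrite [q == p]eq_sym [j == i]eq_sym [(ordS j == i) || _]orbC orbb.
  case/and4P=> _ /eqP <- _ /orP[] /eqP <-; rewrite ordSE.
    by exists p, i; split=> //; left; rewrite valZpK.
  by exists p, j; split=> //; right; rewrite valZpK.
case/andP=> _ /orP[] /existsP[u /existsP[v /and3P[/edge uv /eqP <- /eqP <-]]].
  by case: uv => p [k [kn [[-> ->]|[-> ->]]]]; exists p, k; split=> //;
    [left|right].
by case: uv => p [k [kn [[-> ->]|[-> ->]]]]; exists p, k; split=> //;
  [right|left].
Qed.
End Windmill.

(** * Strands of the uniform theta graph *)

Section Theta.
Variables (t n : nat).
Local Notation T := (theta_graph t n.+1).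

(** Path vertices are shifted by one to leave position 0 to the first hub, so a strand has [n.+2]
    edges. The guard keeps [inord] away from its default value. *)
Definition strand (p : 'I_t) (k : nat) : T :=
  if k is k'.+1 then
    if (k' < n.+1)%N then inl (p, inord k' : 'I_n.+1) else inr true
  else inr false.

Lemma strand_inj p p' k k' : (0 < k < n.+2)%N -> (k' <= n.+2)%N ->
  strand p' k' = strand p k -> p' = p /\ k' = k.
Proof.
case: k k' => // k [|k'] /= kn k'n; rewrite ltnS in kn; rewrite kn //.
case: ltnP => // k'n1 [->] /(congr1 val) /=.
by rewrite !inordK // => ->.
Qed.

Lemma strand_adj x y : adj x y <-> exists p k, (k < n.+2)%N /\
  (x = strand p k /\ y = strand p k.+1 \/ y = strand p k /\ x = strand p k.+1).
Proof.
have inner p (i : 'I_n.+1) : inl (p, i) = strand p i.+1.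
  by rewrite /= ltn_ord inord_val.
split=> [|[p [k [kn xyE]]]]; last first.
  suff step : adj (strand p k) (strand p k.+1).
    by case: xyE => -[-> ->] //; rewrite adj_sym.
  have nE : strand p k <> strand p k.+1.
    move=> pE; have [k0|k0] := posnP k.
      have kin : (0 < k.+1 < n.+2)%N by rewrite k0.
      by have [_] := strand_inj kin (ltnW kn) pE; lia.
    have kin : (0 < k < n.+2)%N by rewrite k0.
    by have [_] := strand_inj kin kn (esym pE); lia.
  rewrite /adj /= /simple_rel; move/eqP: nE => -> /=.
  case: k kn {xyE} => [|k] kn /=; first by rewrite inordK // orbT.
  rewrite ltnS in kn; rewrite kn; case: ltnP => k1n /=.
    rewrite /simple_rel /= xpair_eqE eqxx /= -val_eqE /= !inordK // eqxx.
    by rewrite (ltn_eqF (ltnSn k)).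
  by rewrite inordK //; lia.
(* This is the relation defining [theta_graph] before symmetrization, which only exchanges the two
   cases of the conclusion. *)
have edge u v : (match u, v with
       | inl p, inl q => adj (p : disjoint_copies t (path_graph n.+1)) q
       | inl (_, k), inr false => k == 0%N :> nat
       | inl (_, k), inr true => k == n :> nat
       | inr _, _ => false
       end) -> exists p k, (k < n.+2)%N /\
  (u = strand p k /\ v = strand p k.+1 \/ v = strand p k /\ u = strand p k.+1).
  case: u v => [[p i]|//] [[q j]|[] /eqP iE].
  - rewrite /adj /= /simple_rel /=.
    rewrite [q == p]eq_sym [j == i]eq_sym [(j.+1 == i :> nat) || _]orbC orbb.
    case/and4P=> _ /eqP <- _ /orP[] /eqP ijE.
      exists p, i.+1; split; first by rewrite ltnS.
      by left; split; [|rewrite ijE]; exact: inner.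
    exists p, j.+1; split; first by rewrite ltnS.
    by right; split; [|rewrite ijE]; exact: inner.
  - exists p, i.+1; split; first by rewrite ltnS.
    by left; split; [exact: inner | rewrite /= iE ltnn].
  - by exists p, 0; split=> //; right; split=> //; have := inner p i; rewrite iE.
case/andP=> _ /orP[] /edge [p [k [kn xyE]]]; exists p, k; split=> //.
by case: xyE; [right|left].
Qed.
End Theta.

Theorem theorem1p1 (R : realType) :
  (forall t n : nat, (2 <= t)%N -> (3 <= n)%N ->
     periodic (dutch_windmill n t) R (2 * n)%N) /\
  (forall t n : nat, (1 <= t)%N -> (1 <= n)%N ->
     periodic (theta_graph t n) R (2 * n + 2)%N).
Proof.
split=> t [//|n] t_gt n_gt.
  have p0 : 'I_t by exact: (Ordinal (ltnW t_gt)).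
  apply: (@bundle_periodic _ R _ (@petal t n) n.+1 _ _ _ _ _ _ p0).
  - exact: ltnW.
  - exact: petal_adj (ltnW n_gt).
  - exact: petal_inj.
  - by move=> p p'; rewrite !petal_hub.
  - by move=> p p'; rewrite !petal_hub.
  (* Petals are loops, so both loop conditions have content: cycle length at least 3 gives this one,
     and two copies give the next. *)
  - by [].
  - by rewrite card_ord.
have p0 : 'I_t by exact: (Ordinal t_gt).
have -> : (2 * n.+1 + 2 = 2 * n.+2)%N by lia.
apply: (@bundle_periodic _ R _ (@strand t n) n.+2 _ _ _ _ _ _ p0).
- by [].
- exact: strand_adj.
- exact: strand_inj.
- by [].
- by move=> p p'; rewrite /= ltnn.
(* The two hubs of a theta graph are distinct, so both loop conditions hold vacuously. *)
- by move=> p; rewrite /= ltnn.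
- by rewrite /= ltnn.
Qed.
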